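(* Let $m\ge1$ and, for each $i\in[m]$, observe $X_{ij}=\mu_{xi}+\epsilon_{xij}$, $j\in[n_{xi}]$, and $Y_{ij}=\mu_{yi}+\epsilon_{yij}$, $j\in[n_{yi}]$, with $\mathbb{E}\epsilon_{xij}=\mathbb{E}\epsilon_{yij}=0$, unknown constants $\mu_{xi},\mu_{yi}$, and $n_{xi}\ge4$, $n_{yi}\ge4$. Let $\mathcal{H}_0=\{i:\mu_{xi}=\mu_{yi}\}$, $\mathbf{X}_i=(X_{ij}:j\in[n_{xi}])$, $\mathbf{Y}_i=(Y_{ij}:j\in[n_{yi}])$ and $\mathbf{K}_{-i}=(\mathbf{X}_k,\mathbf{Y}_k:k\ne i)$. Assume that for every $i\in\mathcal{H}_0$: conditional on $\mathbf{K}_{-i}$, $\{\epsilon_{xij}\}_j$ is independent of $\{\epsilon_{yij}\}_j$; conditional on $\mathbf{K}_{-i}$, $\{\epsilon_{xij}\}_j$ are i.i.d. and $\{\epsilon_{yij}\}_j$ are i.i.d.; and their conditional densities satisfy $f^{\epsilon}_{xi}(-x\mid\mathbf{K}_{-i})=f^{\epsilon}_{xi}(x\mid\mathbf{K}_{-i})$ and $f^{\epsilon}_{yi}(-y\mid\mathbf{K}_{-i})=f^{\epsilon}_{yi}(y\mid\mathbf{K}_{-i})$. Construct $(T_i,T_i^0)$ as follows. Randomly (independently of the data) partition $[n_{xi}]$ into $\mathcal{N}_{xi1},\mathcal{N}_{xi2}$ of sizes $n_{xi1}=\lceil n_{xi}/2\rceil$, $n_{xi2}=n_{xi}-n_{xi1}$,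 and $[n_{yi}]$ into $\mathcal{N}_{yi1},\mathcal{N}_{yi2}$ of sizes $n_{yi1}=\lceil n_{yi}/2\rceil$, $n_{yi2}=n_{yi}-n_{yi1}$. For $k=1,2$ let $\bar X_{ik},\bar Y_{ik}$ be the sample means and $S^2_{xik},S^2_{yik}$ the sample variances (divisor size minus one) over $\mathcal{N}_{xik}$, $\mathcal{N}_{yik}$. Let $S^2_{xi}=\frac{(n_{xi1}-1)S^2_{xi1}+(n_{xi2}-1)S^2_{xi2}}{n_{xi}-2}$, $S^2_{yi}=\frac{(n_{yi1}-1)S^2_{yi1}+(n_{yi2}-1)S^2_{yi2}}{n_{yi}-2}$, $V_i=(\bar X_{i1}-\bar Y_{i1})+(\bar X_{i2}-\bar Y_{i2})$, $V_i^0=(\bar X_{i1}-\bar Y_{i1})-(\bar X_{i2}-\bar Y_{i2})$, $S_i=\sqrt{\frac{n_{xi}}{n_{xi1}n_{xi2}}S^2_{xi}+\frac{n_{yi}}{n_{yi1}n_{yi2}}S^2_{yi}}$, and $T_i=\Phi^{-1}\{G_{t,n_{xi}+n_{yi}-4}(V_i/S_i)\}$, $T_i^0=\Phi^{-1}\{G_{t,n_{xi}+n_{yi}-4}(V_i^0/S_i)\}$. Then for every $i\in\mathcal{H}_0$, $$(T_i,T_i^0\mid \mathbf{T}_{-i},\mathbf{T}^0_{-i})\stackrel{d}{=}(T_i^0,T_i\mid \mathbf{T}_{-i},\mathbf{T}^0_{-i}),$$ where $\mathbf{T}_{-i}=(T_k:k\ne i)$ and $\mathbf{T}^0_{-i}=(T^0_k:k\ne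 i)$.
   Context: $\Phi$ is the standard normal CDF and $G_{t,\nu}$ the CDF of the $t$-distribution with $\nu$ degrees of freedom. *)

(* Defs.v *)
From HB Require Import structures.
From mathcomp Require Import all_boot all_order all_algebra.
From mathcomp Require Import all_classical all_reals all_analysis.
Set Implicit Arguments. Unset Strict Implicit. Unset Printing Implicit Defensive.
Import Order.TTheory GRing.Theory Num.Theory.
Import numFieldNormedType.Exports.
Local Open Scope classical_set_scope.
Local Open Scope ring_scope.

Section defs.
Context {R : realType}.

Definition Phi (x : R) : R := fine (normal_prob 0 1 `]-oo, x]).
Definition Phi_inv (p : R) : R := xget 0 [set x | Phi x = p].

Definition t_kernel (nu : nat) (t : R) : R :=
  (1 + t ^+ 2 / nu%:R) `^ (- ((nu%:R + 1) / 2)).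
Definition G_t (nu : nat) (x : R) : R :=
  fine (\int[lebesgue_measure]_(t in `]-oo, x]) (t_kernel nu t)%:E)%E /
  fine (\int[lebesgue_measure]_(t in [set: R]) (t_kernel nu t)%:E)%E.

Definition smean n (f : 'I_n -> R) (s : {set 'I_n}) : R :=
  (\sum_(j in s) f j) / #|s|%:R.
Definition svar n (f : 'I_n -> R) (s : {set 'I_n}) : R :=
  (\sum_(j in s) (f j - smean f s) ^+ 2) / (#|s|.-1)%:R.
End defs.

Section model.
Context {R : realType} {d : measure_display} {Omega : measurableType d}.
Local Open Scope ereal_scope.

Definition Tstat (nx ny : nat) (x : 'I_nx -> R) (y : 'I_ny -> R)
  (sx : {set 'I_nx}) (sy : {set 'I_ny}) (null : bool) : R :=
  let nx1 := uphalf nx in let nx2 := (nx - nx1)%N in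
  let ny1 := uphalf ny in let ny2 := (ny - ny1)%N in
  let S2x := (((nx1.-1)%:R * svar x sx + (nx2.-1)%:R * svar x (~: sx))
               / (nx - 2)%:R)%R in
  let S2y := (((ny1.-1)%:R * svar y sy + (ny2.-1)%:R * svar y (~: sy))
               / (ny - 2)%:R)%R in
  let D1 := (smean x sx - smean y sy)%R in
  let D2 := (smean x (~: sx) - smean y (~: sy))%R in
  let V := (if null then D1 - D2 else D1 + D2)%R in
  let S := Num.sqrt (nx%:R / (nx1 * nx2)%:R * S2x
                     + ny%:R / (ny1 * ny2)%:R * S2y)%R in
  Phi_inv (G_t (nx + ny - 4) (V / S)%R).

Definition data_gen (m : nat) (nx ny : 'I_m -> nat)
  (X Y : 'I_m -> nat -> Omega -> R) (excl : pred 'I_m) : set (set Omega) :=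
  [set E | exists k j (A : set R), ~~ excl k /\ measurable A /\
     (((j < nx k)%N /\ E = X k j @^-1` A) \/ ((j < ny k)%N /\ E = Y k j @^-1` A))].

Definition cond_iid_sym_density (P : probability Omega R) (gK : set (set Omega))
  (nx ny : nat) (ex ey : nat -> Omega -> R) : Prop :=
  exists fx fy : Omega -> R -> R,
    [/\ (forall w t, (0 <= fx w t)%R /\ (0 <= fy w t)%R),
        (forall w (t : R), fx w (- t)%R = fx w t /\ fy w (- t)%R = fy w t),
        (forall w, measurable_fun setT (fx w) /\ measurable_fun setT (fy w)),
        (forall w, (\int[lebesgue_measure]_(t in [set: R]) (fx w t)%:E = 1) /\
                   (\int[lebesgue_measure]_(t in [set: R]) (fy w t)%:E = 1)) &
        (forall B : set R, measurable B -> forall U : set R, measurable U ->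
           <<s gK >> ((fun w => fine (\int[lebesgue_measure]_(t in B) (fx w t)%:E))
                       @^-1` U) /\
           <<s gK >> ((fun w => fine (\int[lebesgue_measure]_(t in B) (fy w t)%:E))
                       @^-1` U))] /\
        (forall A : set Omega, <<s gK >> A ->
         forall Bx By : nat -> set R,
           (forall j, measurable (Bx j)) -> (forall j, measurable (By j)) ->
           P (A `&` [set w | (forall j, (j < nx)%N -> Bx j (ex j w)) /\
                             (forall j, (j < ny)%N -> By j (ey j w))])
           = \int[P]_(w in A)
               ((\prod_(j < nx) fine (\int[lebesgue_measure]_(t in Bx j) (fx w t)%:E))
              * (\prod_(j < ny) fine (\int[lebesgue_measure]_(t in By j) (fy w t)%:E)))%:E).

(* (T_i, T0_i | T_{-i}, T0_{-i}) =d (T0_i, T_i | T_{-i}, T0_{-i}), i.e. the joint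
   law of (T_i, T0_i, T_{-i}, T0_{-i}) equals that of (T0_i, T_i, T_{-i}, T0_{-i})
   (tested on measurable rectangles, which determine the joint law). *)
Definition cond_swap_exch (P : probability Omega R) (m : nat)
  (T T0 : 'I_m -> Omega -> R) (i : 'I_m) : Prop :=
  forall (A1 A2 : set R) (C D : 'I_m -> set R),
    measurable A1 -> measurable A2 ->
    (forall k, measurable (C k)) -> (forall k, measurable (D k)) ->
    P [set w | [/\ A1 (T i w), A2 (T0 i w) &
                 forall k, k != i -> C k (T k w) /\ D k (T0 k w)]]
    = P [set w | [/\ A1 (T0 i w), A2 (T i w) &
                 forall k, k != i -> C k (T k w) /\ D k (T0 k w)]].
End model.

(* Main.v *)
(* Fix the splits of all coordinates: there are finitely many choices, and they
   are independent of the data. When mu_xi = mu_yi = mu, reflecting about mu the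
   observations of the second halves N_xi2 and N_yi2 exchanges V_i and V_i^0 and
   preserves S_i, hence exchanges T_i and T_i^0. Given K_{-i}, the errors of
   coordinate i are independent with even densities, so this reflection preserves
   the joint law of (K_{-i}, X_i, Y_i) on measurable rectangles, and therefore
   everywhere by the pi-lambda theorem. *)
Require Import Defs.
From HB Require Import structures.
From mathcomp Require Import all_boot all_order all_algebra.
From mathcomp Require Import all_classical all_reals all_analysis measurable_realfun.
From mathcomp Require Import ring zify.
Set Implicit Arguments.
Unset Strict Implicit.
Unset Printing Implicit Defensive.
Import Order.TTheory GRing.Theory Num.Theory.
Import numFieldNormedType.Exports.
Local Open Scope classical_set_scope.
Local Open Scope ring_scope.

(** * The normal CDF, its inverse, and the t CDF: monotonicity and measurability *)

(** The increment is the normal mass of []x, y]], and the density lies between 0 and its peak. One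
    bound thus yields both monotonicity and a Lipschitz estimate. *)
Lemma PhiB_le (R : realType) (x y : R) : x <= y ->
  0 <= Phi y - Phi x <= normal_peak 1 * (y - x).
Proof.
move=> xy; pose N : probability (measurableTypeR R) R := normal_prob (0 : R) 1.
have fN (A : set R) : measurable A -> N A \is a fin_num by move=> mA; exact: fin_num_measure.
have Ey : `]-oo, y]%classic = `]-oo, x] `|` `]x, y].
  by rewrite -itv_bndbnd_setU.
have -> : Phi y - Phi x = fine (N `]x, y]%classic).
  rewrite /Phi Ey measureU//=.
    by rewrite fineD ?fN// addrAC subrr add0r.
  apply/seteqP; split=> // t []/=; rewrite !in_itv/= => tx.
  by move=> /andP[/(le_lt_trans tx)]; rewrite ltxx.
apply/andP; split; first by rewrite fine_ge0// (measure_ge0 N).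
rewrite -lee_fin fineK ?fN// /N /normal_prob.
have -> : (normal_peak 1 * (y - x))%:E =
    (\int[lebesgue_measure]_(t in `]x, y]) (normal_peak (1 : R))%:E)%E.
  rewrite integral_cst//= lebesgue_measure_itv/= lte_fin EFinM.
  by case: ltgtP xy => // -> _; rewrite subrr mule0.
apply: ge0_le_integral => //=.
- by move=> t _; rewrite lee_fin normal_pdf_ge0.
- by apply/measurable_EFinP; apply: measurable_funTS; exact: measurable_normal_pdf.
- by move=> t _; rewrite lee_fin normal_pdf_ub// oner_neq0.
Qed.

Lemma Phi_nondecreasing (R : realType) : nondecreasing_fun (@Phi R).
Proof. by move=> x y /PhiB_le/andP[+ _]; rewrite subr_ge0. Qed.

Lemma Phi_continuous (R : realType) : continuous (@Phi R).
Proof.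
have lip (x y : R) : `|Phi x - Phi y| <= normal_peak 1 * `|x - y|.
  wlog xy : x y / y <= x => [H|].
    have [/H//|/ltW/H] := leP y x.
    by rewrite distrC (distrC y).
  by have /andP[h1 h2] := PhiB_le xy; rewrite !ger0_norm ?subr_ge0// -subr_ge0.
have k0 : 0 < normal_peak (1 : R) by rewrite normal_peak_gt0 ?oner_neq0.
move=> x; apply/cvgrPdist_le => e e0; near=> y.
apply: (le_trans (lip _ _)); rewrite -ler_pdivlMl//.
near: y; apply: cvgr_dist_le; first exact: cvg_id.
by rewrite mulr_gt0// invr_gt0.
Unshelve. all: end_near. Qed.

(** By the intermediate value theorem for the continuous [Phi]. Its use is that an interval is a
    Borel set, so that [Phi_inv] can be studied separately on and off the range. *)
Lemma range_Phi_interval (R : realType) : is_interval (range (@Phi R)).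
Proof.
move=> _ _ [a _ <-] [b _ <-] v /andP[av vb].
have [ba|/ltW ab] := leP b a.
  exists a => //; apply/eqP; rewrite eq_le av/=.
  exact: (le_trans vb (Phi_nondecreasing ba)).
have [||c _ <-] := @IVT _ (@Phi R) a b v ab; last by exists c.
- exact/continuous_subspaceT/Phi_continuous.
- by rewrite min_l ?max_r ?Phi_nondecreasing// av vb.
Qed.

Lemma Phi_invK (R : realType) (p : R) : range (@Phi R) p -> Phi (Phi_inv p) = p.
Proof. by move=> [x _ xp]; apply: (@xgetPex _ 0 [set x | Phi x = p]); exists x. Qed.

Lemma Phi_inv_out (R : realType) (p : R) : ~ range (@Phi R) p -> Phi_inv p = 0.
Proof. by move=> np; apply: xgetPN => x xp; apply: np; exists x. Qed.

(* [Phi_inv] is monotone on the range of [Phi], which is an interval, and has the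
   junk value [0] elsewhere. *)
Lemma measurable_Phi_inv (R : realType) : measurable_fun setT (@Phi_inv R).
Proof.
have mr := is_interval_measurable (@range_Phi_interval R).
apply: (measurability (@RGenCInfty.G R)) => [|/= _ [_] [r] -> <-].
  exact: RGenCInfty.measurableE.
rewrite setTI.
pose E := @Phi_inv R @^-1` `[r, +oo[.
rewrite -[_ @^-1` _]/E -(setUIDK E (range (@Phi R))).
apply: measurableU.
  apply: is_interval_measurable => p q [Ep rp] [Eq rq] u /andP[pu uq].
  have ru : range (@Phi R) u by apply: (range_Phi_interval rp rq); rewrite pu.
  split=> //; move: Ep; rewrite /E/= !in_itv/= !andbT => /le_trans; apply.
  (* If [Phi_inv u] were below [Phi_inv p], applying the monotone [Phi] would give [u <= p], hence
     [p = u]. *)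
  have [->//|pnu] := eqVneq p u; rewrite leNgt; apply/negP.
  move=> /ltW/Phi_nondecreasing; rewrite !Phi_invK// => up.
  by move: pnu; rewrite eq_le pu up.
(* Off the range the value is 0, so that part of the preimage is everything or nothing according to
   the sign of [r]. *)
- rewrite (_ : E `\` _ = if r <= 0 then ~` range (@Phi R) else set0).
    by case: ifP => // _; exact: measurableC.
  apply/seteqP; split=> p; rewrite /E/=.
    by move=> [+ np]; rewrite Phi_inv_out// in_itv/= andbT => ->.
  case: ifPn => // r0 np; split=> //.
  by rewrite Phi_inv_out// in_itv/= andbT.
Qed.

(** If the kernel has finite mass, [G_t] is nondecreasing, as a normalised integral of a nonnegative
    function; otherwise it is constant. *)
Lemma measurable_G_t (R : realType) (nu : nat) : measurable_fun setT (@G_t R nu).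
Proof.
have mk : measurable_fun setT (@t_kernel R nu).
  apply: (measurableT_comp (measurable_powR _)).
  apply: measurable_funD => //.
  by apply: measurable_funM => //; exact: exprn_measurable.
have k0 (t : R) : 0 <= t_kernel nu t by exact: powR_ge0.
have mE : measurable_fun setT (EFin \o @t_kernel R nu) by exact/measurable_EFinP.
pose I (A : set R) : \bar R :=
  (\int[lebesgue_measure]_(t in A) (t_kernel nu t)%:E)%E.
have I0 A : (0 <= I A)%E by apply: integral_ge0 => t _; rewrite lee_fin.
have Imon (A B : set R) : measurable A -> measurable B -> A `<=` B -> (I A <= I B)%E.
  move=> mA mB AB; apply: ge0_subset_integral => // [|t _]; rewrite ?lee_fin//.
  exact: measurable_funTS mE.
have GE x : G_t nu x = fine (I `]-oo, x]%classic) / fine (I setT) by [].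
(* If the total mass were infinite, [fine] would make the denominator [0], hence [G_t] null. *)
have [finT|infT] := boolP (I setT \is a fin_num); last first.
  rewrite (_ : G_t nu = cst 0)//; apply/funext => x; rewrite GE.
  by case: (I setT) infT => // *; rewrite /= invr0 mulr0.
have finI A : measurable A -> I A \is a fin_num.
  move=> mA; rewrite ge0_fin_numE//; apply: (@le_lt_trans _ _ (I setT)).
    exact: Imon.
  by rewrite -ge0_fin_numE.
apply: nondecreasing_measurable => // x y xy.
rewrite !GE ler_wpM2r ?invr_ge0 ?fine_ge0//.
rewrite fine_le ?finI//; apply: Imon => //.
by move=> t/=; rewrite !in_itv/= => /le_trans; apply.
Qed.

(** * Sample statistics: measurability and behaviour under reflection *)

Section sample_statistics.
Context {R : realType}.
Implicit Types (n : nat).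

Lemma measurable_smean d (T : measurableType d) n (f : 'I_n -> T -> R)
    (s : {set 'I_n}) :
  (forall j, measurable_fun setT (f j)) ->
  measurable_fun setT (fun z => smean (f^~ z) s).
Proof.
move=> mf; apply: measurable_funM => //.
under eq_fun do rewrite big_mkcond.
by apply: measurable_sum => j; case: (j \in s).
Qed.

Lemma measurable_svar d (T : measurableType d) n (f : 'I_n -> T -> R)
    (s : {set 'I_n}) :
  (forall j, measurable_fun setT (f j)) ->
  measurable_fun setT (fun z => svar (f^~ z) s).
Proof.
move=> mf; apply: measurable_funM => //.
under eq_fun do rewrite big_mkcond.
apply: measurable_sum => j; case: (j \in s) => //.
by apply: measurable_funX; apply: measurable_funB => //; exact: measurable_smean.
Qed.

Lemma measurable_Phi_inv_G_t d (T : measurableType d) nu (V S : T -> R) :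
  measurable_fun setT V -> measurable_fun setT S -> (forall z, 0 <= S z) ->
  measurable_fun setT (fun z => Phi_inv (G_t nu (V z / S z))).
Proof.
move=> mV mS S0.
(* For [S z >= 0] the inverse is the real power with exponent -1, also at 0 where both are 0;
   measurability of powers then covers the quotient. *)
have -> : (fun z => Phi_inv (G_t nu (V z / S z))) =
    @Phi_inv R \o @G_t R nu \o (fun z => V z * S z `^ (-1)).
  by apply/funext => z /=; rewrite powR_inv1.
apply: (measurableT_comp (@measurable_Phi_inv R)).
apply: (measurableT_comp (@measurable_G_t R nu)).
apply: measurable_funM => //.
by apply: (measurableT_comp (measurable_powR _)).
Qed.

Lemma measurable_Tstat d (T : measurableType d) nx ny
    (x : 'I_nx -> T -> R) (y : 'I_ny -> T -> R) sx sy b :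
  (forall j, measurable_fun setT (x j)) ->
  (forall j, measurable_fun setT (y j)) ->
  measurable_fun setT (fun z => Tstat (x^~ z) (y^~ z) sx sy b).
Proof.
move=> mx my.
have mD sx' sy' : measurable_fun setT
    (fun z => smean (x^~ z) sx' - smean (y^~ z) sy').
  by apply: measurable_funB; exact: measurable_smean.
apply: measurable_Phi_inv_G_t => [||z]; last exact: sqrtr_ge0.
  by case: b; [apply: measurable_funB|apply: measurable_funD]; exact: mD.
apply: (measurableT_comp (continuous_measurable_fun (@sqrt_continuous R))).
by do ![exact: measurable_svar|exact: measurable_cst|
        apply: measurable_funD|apply: measurable_funM].
Qed.

Lemma eq_smean n (f g : 'I_n -> R) (s : {set 'I_n}) : {in s, f =1 g} -> smean f s = smean g s.
Proof. by move=> fg; rewrite /smean (eq_bigr g). Qed.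

Lemma eq_svar n (f g : 'I_n -> R) (s : {set 'I_n}) : {in s, f =1 g} -> svar f s = svar g s.
Proof.
move=> fg; rewrite /svar (eq_smean fg).
by under eq_bigr => j js do rewrite fg//.
Qed.

Lemma smean_reflect n (f : 'I_n -> R) c (s : {set 'I_n}) : (0 < #|s|)%N ->
  smean (fun j => c - f j) s = c - smean f s.
Proof.
move=> s0; rewrite /smean big_split/= sumr_const sumrN mulrDl mulNr -(mulr_natr c).
by rewrite mulfK// pnatr_eq0 -lt0n.
Qed.

(** The mean is reflected along with the data, so each deviation only changes sign. *)
Lemma svar_reflect n (f : 'I_n -> R) c (s : {set 'I_n}) : (0 < #|s|)%N ->
  svar (fun j => c - f j) s = svar f s.
Proof.
move=> s0; rewrite /svar smean_reflect//; congr (_ / _).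
by apply: eq_bigr => j _; ring.
Qed.

Lemma eq_Tstat nx ny (x x' : 'I_nx -> R) (y y' : 'I_ny -> R)
    (sx : {set 'I_nx}) (sy : {set 'I_ny}) b :
  x =1 x' -> y =1 y' -> Tstat x y sx sy b = Tstat x' y' sx sy b.
Proof. by move=> /funext -> /funext ->. Qed.

(** The same [c] serves both samples, so it cancels in the difference of second-half means, which
    merely changes sign, while all variances stay put. Hence the sum and the difference of the two
    half contrasts trade places over an unchanged denominator. *)
Lemma Tstat_reflect nx ny (x x' : 'I_nx -> R) (y y' : 'I_ny -> R) c
    (sx : {set 'I_nx}) (sy : {set 'I_ny}) b :
  (forall j, x' j = if j \in sx then x j else c - x j) ->
  (forall j, y' j = if j \in sy then y j else c - y j) ->
  (0 < #|~: sx|)%N -> (0 < #|~: sy|)%N ->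
  Tstat x' y' sx sy b = Tstat x y sx sy (~~ b).
Proof.
move=> x'E y'E sx0 sy0.
have xx' : {in sx, x' =1 x} by move=> j js; rewrite x'E js.
have yy' : {in sy, y' =1 y} by move=> j js; rewrite y'E js.
have xx'C : {in ~: sx, x' =1 fun j => c - x j}.
  by move=> j; rewrite inE x'E => /negbTE ->.
have yy'C : {in ~: sy, y' =1 fun j => c - y j}.
  by move=> j; rewrite inE y'E => /negbTE ->.
rewrite /Tstat (eq_smean xx') (eq_smean yy') (eq_smean xx'C) (eq_smean yy'C).
rewrite (eq_svar xx') (eq_svar yy') (eq_svar xx'C) (eq_svar yy'C).
rewrite !smean_reflect// !svar_reflect//.
have -> : forall u v : R, c - u - (c - v) = - (u - v) by move=> u v; ring.
by case: b; rewrite /= ?opprK.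
Qed.

End sample_statistics.

(** * Sign symmetry of the errors given the other coordinates *)

(** Change of variables [t] to [- t], which preserves both Lebesgue measure and [f]. *)
Lemma integral_even_preimageN (R : realType) (f : R -> R) (B : set R) :
  measurable B -> measurable_fun setT f -> (forall t, 0 <= f t) ->
  (forall t, f (- t) = f t) ->
  (\int[lebesgue_measure]_(t in -%R @^-1` B) (f t)%:E
   = \int[lebesgue_measure]_(t in B) (f t)%:E)%E.
Proof.
move=> mB mf f0 fN.
transitivity (\int[pushforward (@lebesgue_measure R)
    (-%R : R -> measurableTypeR R)]_(t in B) (f t)%:E)%E.
  rewrite ge0_integral_pushforward//=.
  - by apply: eq_integral => t _; rewrite fN.
  - by apply: measurable_funTS; exact/measurable_EFinP.
  - by move=> t _; rewrite lee_fin.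
by apply: eq_measure_integral => //= A mA _; exact: lebesgue_measureN.
Qed.

Section sign_flip.
Context {R : realType} {d : measure_display} {Omega : measurableType d}.

(** A pi-system for the joint law of the conditioning data and the errors. The conditioning enters
    as an event of [<<s G>>] on [Omega] itself; the error sequences are constrained only at the
    indices of actual observations. *)
Definition rectangles (nx ny : nat) (G : set (set Omega)) :
    set (set (Omega * ((nat -> R) * (nat -> R)))) :=
  [set Q | exists (A : set Omega) (Bx By : nat -> set R),
    [/\ <<s G >> A, forall j, measurable (Bx j), forall j, measurable (By j) &
     Q = [set z | A z.1 /\ ((forall j, (j < nx)%N -> Bx j (z.2.1 j)) /\
                            (forall j, (j < ny)%N -> By j (z.2.2 j)))]]].

Definition flip (b : nat -> bool) (e : nat -> R) (j : nat) : R :=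
  if b j then - e j else e j.

Lemma setI_closed_rectangles nx ny G : setI_closed (rectangles nx ny G).
Proof.
move=> _ _ [A [Bx [By [sA mBx mBy ->]]]] [A' [Bx' [By' [sA' mBx' mBy' ->]]]].
exists (A `&` A'), (fun j => Bx j `&` Bx' j), (fun j => By j `&` By' j).
split.
- exact: (@measurableI _ (g_sigma_algebraType G)).
- by move=> j; exact: measurableI.
- by move=> j; exact: measurableI.
apply/seteqP; split=> -[w [e e']]/=.
  move=> [[Aw [Be Be']] [Aw' [Ce Ce']]]; split=> //.
  by split=> j jn; split; [exact: Be|exact: Ce|exact: Be'|exact: Ce'].
move=> [[Aw Aw'] [Be Be']]; by split; split=> //; split=> j jn;
  [case: (Be _ jn)|case: (Be' _ jn)|case: (Be _ jn)|case: (Be' _ jn)].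
Qed.

Lemma rectangles_base nx ny G (A : set Omega) : <<s G >> A ->
  <<s rectangles nx ny G >> [set z | A z.1].
Proof.
move=> sA; apply: sub_sigma_algebra; exists A, (fun=> setT), (fun=> setT).
by split=> //; apply/seteqP; split=> // z [].
Qed.

Lemma measurable_fst_coordinate nx ny G j : (j < nx)%N ->
  measurable_fun setT
    (fun z : g_sigma_algebraType (rectangles nx ny G) => z.2.1 j).
Proof.
move=> jn _ B mB; rewrite setTI; apply: sub_sigma_algebra.
exists setT, (fun k => if k == j then B else setT), (fun=> setT); split=> //.
- exact: (@measurableT _ (g_sigma_algebraType G)).
- by move=> k; case: ifP.
apply/seteqP; split=> z /=; last by move=> [_ [/(_ j jn)]]; rewrite eqxx.
by move=> Bz; do 2!split=> //; move=> k _; case: eqP => // ->.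
Qed.

Lemma measurable_snd_coordinate nx ny G j : (j < ny)%N ->
  measurable_fun setT
    (fun z : g_sigma_algebraType (rectangles nx ny G) => z.2.2 j).
Proof.
move=> jn _ B mB; rewrite setTI; apply: sub_sigma_algebra.
exists setT, (fun=> setT), (fun k => if k == j then B else setT); split=> //.
- exact: (@measurableT _ (g_sigma_algebraType G)).
- by move=> k; case: ifP.
apply/seteqP; split=> z /=; last by move=> [_ [_ /(_ j jn)]]; rewrite eqxx.
by move=> Bz; do 2!split=> //; move=> k _; case: eqP => // ->.
Qed.

Variables (P : probability Omega R) (G : set (set Omega)) (nx ny : nat).
Variables (ex ey : nat -> Omega -> R).
Hypothesis mG : <<s G >> `<=` measurable.
Hypothesis mex : forall j, (j < nx)%N -> measurable_fun setT (ex j).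
Hypothesis mey : forall j, (j < ny)%N -> measurable_fun setT (ey j).

(** The laws to be compared are image laws of [P] under such maps. The first component keeps [w], so
    that events of [G] can still be read off. *)
Let phi (bx bY : nat -> bool) (w : Omega) :
    g_sigma_algebraType (rectangles nx ny G) :=
  (w, (flip bx (ex^~ w), flip bY (ey^~ w))).

(** Signs move from the point to the box, so the preimage again has the form to which the
    conditional law applies. *)
Let phi_rect bx bY (A : set Omega) (Bx By : nat -> set R) :
  phi bx bY @^-1` [set z | A z.1 /\ ((forall j, (j < nx)%N -> Bx j (z.2.1 j)) /\
                            (forall j, (j < ny)%N -> By j (z.2.2 j)))] =
  A `&` [set w | (forall j, (j < nx)%N ->
                     (if bx j then -%R @^-1` Bx j else Bx j) (ex j w)) /\
                 (forall j, (j < ny)%N ->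
                     (if bY j then -%R @^-1` By j else By j) (ey j w))].
Proof.
apply/seteqP; split=> w/= [Aw [Bw Bw']]; split=> //; split=> j jn;
  [move: (Bw j jn)|move: (Bw' j jn)|move: (Bw j jn)|move: (Bw' j jn)];
  by rewrite /flip; case: ifP.
Qed.

Let measurable_preimageN_if (b : bool) (B : set R) : measurable B ->
  measurable (if b then -%R @^-1` B else B).
Proof.
by case: b => // mB; rewrite -[X in measurable X]setTI; exact: oppr_measurable.
Qed.

Let measurable_box n (e : nat -> Omega -> R) (B : nat -> set R) :
  (forall j, (j < n)%N -> measurable_fun setT (e j)) ->
  (forall j, measurable (B j)) ->
  measurable [set w | forall j, (j < n)%N -> B j (e j w)].
Proof.
move=> me mB.
have -> : [set w | forall j, (j < n)%N -> B j (e j w)] =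
    \bigcap_(j in `I_n) (e j @^-1` B j) by [].
apply: fin_bigcap_measurable => [|j jn]; first exact: finite_II.
by rewrite -[X in measurable X]setTI; exact: me.
Qed.

Let measurable_phi bx bY : measurable_fun setT (phi bx bY).
Proof.
apply: (@measurability _ _ _ (g_sigma_algebraType (rectangles nx ny G))
  setT _ (rectangles nx ny G) erefl).
move=> _ [_ [A [Bx [By [sA mBx mBy ->]]]] <-]; rewrite setTI phi_rect.
apply: measurableI; first exact: mG.
apply: measurableI.
  exact: (@measurable_box nx ex (fun j => if bx j then -%R @^-1` Bx j else Bx j)
            mex (fun j => measurable_preimageN_if (bx j) (mBx j))).
exact: (@measurable_box ny ey (fun j => if bY j then -%R @^-1` By j else By j)
          mey (fun j => measurable_preimageN_if (bY j) (mBy j))).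
Qed.

(** On a rectangle, [law] turns both probabilities into integrals over [A] of products of box
    masses, and evenness of the densities makes the factors agree one by one. Uniqueness of measures
    on a pi-system does the rest. *)
Lemma sign_flip_invariance bx bY (Q : set (Omega * ((nat -> R) * (nat -> R)))) :
  cond_iid_sym_density P G nx ny ex ey ->
  <<s rectangles nx ny G >> Q ->
  P [set w | Q (w, (ex^~ w, ey^~ w))] =
  P [set w | Q (w, (flip bx (ex^~ w), flip bY (ey^~ w)))].
Proof.
move=> [fx [fy [[f0 fN mf f1 _] law]]] sQ.
pose X b b' : {mfun Omega >-> g_sigma_algebraType (rectangles nx ny G)} :=
  mfun_Sub (mem_set (@measurable_phi b b')).
(* The unflipped errors are the case of no sign change, so both sides are image laws of the same
   kind. *)
pose b0 (j : nat) := false.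
suff : distribution P (X b0 b0) Q = distribution P (X bx bY) Q by [].
apply: (@measure_unique _ R (g_sigma_algebraType (rectangles nx ny G))
  (rectangles nx ny G) (fun=> setT) erefl _ _ _
  (distribution P (X b0 b0)) (distribution P (X bx bY))) => //.
- exact: setI_closed_rectangles.
- move=> _; exists setT, (fun=> setT), (fun=> setT); split=> //.
    exact: (@measurableT _ (g_sigma_algebraType G)).
  by apply/seteqP; split.
- by rewrite bigcup_const.
- move=> _ [A [Bx [By [sA mBx mBy ->]]]].
  rewrite -[LHS]/(P (phi b0 b0 @^-1` _)) -[RHS]/(P (phi bx bY @^-1` _)).
  rewrite !phi_rect.
  have mN (b : nat -> bool) (B : nat -> set R) j : (forall j, measurable (B j)) ->
      measurable (if b j then -%R @^-1` B j else B j : set R).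
    by move=> mB; exact: measurable_preimageN_if.
  rewrite [LHS](law A sA Bx By mBx mBy).
  rewrite [RHS](law A sA (fun j => if bx j then -%R @^-1` Bx j else Bx j)
    (fun j => if bY j then -%R @^-1` By j else By j)
    (fun j => mN bx Bx j mBx) (fun j => mN bY By j mBy)).
  apply: eq_integral => w _; congr ((_ * _)%:E); apply: eq_bigr => j _;
    congr fine; case: ifP => // _; rewrite integral_even_preimageN//.
all: try by case: (mf w).
all: try by move=> t; case: (f0 w t).
all: try by move=> t; case: (fN w t).
move=> _; apply: le_lt_trans (ltry 1).
by apply: (probability_le1 (distribution P (X b0 b0))).
Qed.
End sign_flip.

(** * The statistics when all splits are fixed *)

(** One choice of first halves for all coordinates at once, as a dependent finite function, so that
    there are finitely many. Sizes are not constrained here. *)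
Definition split_type (m : nat) (nx ny : 'I_m -> nat) :=
  {dffun forall k : 'I_m, {set 'I_(nx k)} * {set 'I_(ny k)}}.

Section fixed_split.
Context {R : realType} {d : measure_display} {Omega : measurableType d}.
Variables (m : nat) (nx ny : 'I_m -> nat) (X Y : 'I_m -> nat -> Omega -> R).

Definition stat_split (c : split_type nx ny) (b : bool) (k : 'I_m) (w : Omega) : R :=
  Tstat (fun j : 'I_(nx k) => X k j w) (fun j : 'I_(ny k) => Y k j w)
        (c k).1 (c k).2 b.

(** Measurability is relative to the data of the coordinates not excluded: [pred1 i] gives the
    conditioning data of [i], [pred0] all the data. *)
Lemma measurable_stat_split (excl : pred 'I_m) c b k : ~~ excl k ->
  measurable_fun setT (stat_split c b k :
    g_sigma_algebraType (data_gen nx ny X Y excl) -> R).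
Proof.
move=> ek; apply: measurable_Tstat => j _ B mB; rewrite setTI.
  apply: sub_sigma_algebra; exists k, j, B; do 2!split=> //.
  by left.
apply: sub_sigma_algebra; exists k, j, B; do 2!split=> //.
by right.
Qed.

Definition others_event (c : split_type nx ny) i (C D : 'I_m -> set R) : set Omega :=
  [set w | forall k, k != i ->
     C k (stat_split c false k w) /\ D k (stat_split c true k w)].

Lemma others_event_data (excl : pred 'I_m) c i (C D : 'I_m -> set R) :
  (forall k, measurable (C k)) -> (forall k, measurable (D k)) ->
  (forall k, k != i -> ~~ excl k) ->
  <<s data_gen nx ny X Y excl >> (others_event c i C D).
Proof.
move=> mC mD ei.
have -> : others_event c i C D = \bigcap_(k in [set k | k != i])
    (stat_split c false k @^-1` C k `&` stat_split c true k @^-1` D k) by [].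
apply: (@fin_bigcap_measurable _ (g_sigma_algebraType (data_gen nx ny X Y excl))).
  exact: finite_finset.
move=> k /ei ek; apply: measurableI; rewrite -[X in measurable X]setTI;
  exact: measurable_stat_split.
Qed.

(** With [b = false] the tested pair is $(T_i,T_i^0)$, with [b = true] it is $(T_i^0,T_i)$; the swap
    is a change of [b]. *)
Definition split_event (c : split_type nx ny) i (b : bool) (A1 A2 : set R)
    (C D : 'I_m -> set R) : set Omega :=
  others_event c i C D `&`
  [set w | A1 (stat_split c b i w) /\ A2 (stat_split c (~~ b) i w)].

(** Places the event in the sigma-algebra of which the splits are assumed independent. *)
Lemma split_event_data c i b A1 A2 (C D : 'I_m -> set R) :
  measurable A1 -> measurable A2 ->
  (forall k, measurable (C k)) -> (forall k, measurable (D k)) ->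
  <<s data_gen nx ny X Y pred0 >> (split_event c i b A1 A2 C D).
Proof.
move=> mA1 mA2 mC mD.
apply: (@measurableI _ (g_sigma_algebraType (data_gen nx ny X Y pred0))).
  exact: others_event_data.
apply: (@measurableI _ (g_sigma_algebraType (data_gen nx ny X Y pred0))
  (stat_split c b i @^-1` A1) (stat_split c (~~ b) i @^-1` A2));
  rewrite -[X in measurable X]setTI; exact: measurable_stat_split.
Qed.

Variable P : probability Omega R.
Hypothesis mX : forall k j, (j < nx k)%N -> measurable_fun setT (X k j).
Hypothesis mY : forall k j, (j < ny k)%N -> measurable_fun setT (Y k j).

Lemma data_measurable excl : <<s data_gen nx ny X Y excl >> `<=` measurable.
Proof.
apply: smallest_sub; first exact: sigma_algebra_measurable.
move=> _ [k [j [A [_ [mA [[jn ->]|[jn ->]]]]]]];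
  rewrite -[X in measurable X]setTI; [exact: mX|exact: mY].
Qed.

Lemma split_event_swap (c : split_type nx ny) i (mu : R) (A1 A2 : set R)
    (C D : 'I_m -> set R) :
  cond_iid_sym_density P (data_gen nx ny X Y (pred1 i)) (nx i) (ny i)
    (fun j w => X i j w - mu) (fun j w => Y i j w - mu) ->
  (0 < #|~: (c i).1|)%N -> (0 < #|~: (c i).2|)%N ->
  measurable A1 -> measurable A2 ->
  (forall k, measurable (C k)) -> (forall k, measurable (D k)) ->
  P (split_event c i false A1 A2 C D) = P (split_event c i true A1 A2 C D).
Proof.
move=> law sx0 sy0 mA1 mA2 mC mD.
set G := data_gen nx ny X Y (pred1 i).
(* The statistics as functions of the errors: adding [mu] back recovers the observations. *)
pose S b (z : g_sigma_algebraType (rectangles (nx i) (ny i) G)) : R :=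
  Tstat (fun j : 'I_(nx i) => z.2.1 j + mu) (fun j : 'I_(ny i) => z.2.2 j + mu)
    (c i).1 (c i).2 b.
have mS b : measurable_fun setT (S b).
  apply: measurable_Tstat => j; apply: measurable_funD => //.
    exact: measurable_fst_coordinate.
  exact: measurable_snd_coordinate.
(* A single set [Q] describes both events, one through the errors and the other through the flipped
   errors. *)
pose Q z := others_event c i C D z.1 /\ (A1 (S false z) /\ A2 (S true z)).
have sQ : <<s rectangles (nx i) (ny i) G >> Q.
  pose M := g_sigma_algebraType (rectangles (R := R) (nx i) (ny i) G).
  have mA b (A : set R) : measurable A -> measurable (S b @^-1` A).
    by move=> mA; rewrite -[X in measurable X]setTI; exact: mS.
  have mO : measurable ([set z | others_event c i C D z.1] : set M).
    by apply: rectangles_base; apply: others_event_data.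
  exact: (measurableI _ _ mO (measurableI _ _ (mA false _ mA1) (mA true _ mA2))).
(* Marks the second half. Errors are indexed by [nat] and splits by ordinals, hence [insub]; indices
   out of range are never flipped. *)
pose side n (s : {set 'I_n}) (j : nat) : bool :=
  if insub j is Some k then k \notin s else false.
have sideE n (s : {set 'I_n}) (j : 'I_n) : side n s j = (j \notin s).
  by rewrite /side valK.
have mx j : (j < nx i)%N -> measurable_fun setT (fun w => X i j w - mu).
  by move=> jn; apply: measurable_funB => //; exact: mX.
have my j : (j < ny i)%N -> measurable_fun setT (fun w => Y i j w - mu).
  by move=> jn; apply: measurable_funB => //; exact: mY.
have SE b w : S b (w, (fun j => X i j w - mu, fun j => Y i j w - mu)) =
    stat_split c b i w.
  by apply: eq_Tstat => j /=; rewrite subrK.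
have SflipE b w : S b (w, (flip (side _ (c i).1) (fun j => X i j w - mu),
                           flip (side _ (c i).2) (fun j => Y i j w - mu))) =
    stat_split c (~~ b) i w.
  (* Negating the error [x - mu] sends the observation [x] to [mu + mu - x]. *)
  by apply: (@Tstat_reflect _ _ _ _ _ _ _ (mu + mu)) => // j;
    rewrite /flip/= sideE; case: (j \in _) => /=; ring.
have -> : split_event c i false A1 A2 C D =
    [set w | Q (w, (fun j => X i j w - mu, fun j => Y i j w - mu))].
  by apply/funext => w; rewrite /Q [RHS]/mkset !SE.
have -> : split_event c i true A1 A2 C D =
    [set w | Q (w, (flip (side _ (c i).1) (fun j => X i j w - mu),
                    flip (side _ (c i).2) (fun j => Y i j w - mu)))].
  by apply/funext => w; rewrite /Q [RHS]/mkset !SflipE.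
exact: (sign_flip_invariance (@data_measurable _) mx my _ _ law sQ).
Qed.
End fixed_split.

(** * Averaging over the random splits *)

Theorem theorem2 (R : realType) (d : measure_display) (Omega : measurableType d)
  (P : probability Omega R) (m : nat) (nx ny : 'I_m -> nat)
  (mux muy : 'I_m -> R) (X Y : 'I_m -> nat -> Omega -> R)
  (partx : forall i : 'I_m, Omega -> {set 'I_(nx i)})
  (party : forall i : 'I_m, Omega -> {set 'I_(ny i)}) :
  (0 < m)%N ->
  (forall i, 4 <= nx i /\ 4 <= ny i)%N ->
  (* observations are random variables; errors eps = X - mu have mean zero *)
  (forall i j, (j < nx i)%N ->
     measurable_fun setT (X i j) /\
     P.-integrable setT (fun w => (X i j w - mux i)%:E) /\
     (\int[P]_w (X i j w - mux i)%:E = 0)%E) ->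
  (forall i j, (j < ny i)%N ->
     measurable_fun setT (Y i j) /\
     P.-integrable setT (fun w => (Y i j w - muy i)%:E) /\
     (\int[P]_w (Y i j w - muy i)%:E = 0)%E) ->
  (* random splits N_{xi1} = partx i, N_{xi2} = its complement, of sizes
     ceil(n/2) and n - ceil(n/2) *)
  (forall i w, #|partx i w| = uphalf (nx i) /\ #|party i w| = uphalf (ny i)) ->
  (forall i (s : {set 'I_(nx i)}) (t : {set 'I_(ny i)}),
     measurable [set w | partx i w = s] /\ measurable [set w | party i w = t]) ->
  (* the splits are independent of the data *)
  (forall (s : forall i, {set 'I_(nx i)}) (t : forall i, {set 'I_(ny i)})
          (B : set Omega),
     <<s data_gen nx ny X Y pred0 >> B ->
     P ([set w | forall i, partx i w = s i /\ party i w = t i] `&` B)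
     = (P [set w | forall i, partx i w = s i /\ party i w = t i] * P B)%E) ->
  (* for i in H0: conditional structure of the errors given K_{-i} *)
  (forall i, mux i = muy i ->
     cond_iid_sym_density P (data_gen nx ny X Y (pred1 i)) (nx i) (ny i)
       (fun j w => X i j w - mux i) (fun j w => Y i j w - muy i)) ->
  forall i, mux i = muy i ->
    cond_swap_exch P
      (fun k w => Tstat (fun j : 'I_(nx k) => X k j w) (fun j : 'I_(ny k) => Y k j w)
                        (partx k w) (party k w) false)
      (fun k w => Tstat (fun j : 'I_(nx k) => X k j w) (fun j : 'I_(ny k) => Y k j w)
                        (partx k w) (party k w) true)
      i.
Proof.
move=> _ n4 HX HY Hcard mpart indep Hlaw i muE A1 A2 C D mA1 mA2 mC mD.
have mX k j : (j < nx k)%N -> measurable_fun setT (X k j) by move=> /HX[].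
have mY k j : (j < ny k)%N -> measurable_fun setT (Y k j) by move=> /HY[].
pose cfg (c : split_type nx ny) : set Omega :=
  [set w | forall k, partx k w = (c k).1 /\ party k w = (c k).2].
have mcfg c : measurable (cfg c).
  have -> : cfg c = \bigcap_(k in setT)
      ([set w | partx k w = (c k).1] `&` [set w | party k w = (c k).2]).
    by apply/seteqP; split=> w cw k; [move=> _|]; exact: cw.
  apply: fin_bigcap_measurable => [|k _]; first exact: finite_finset.
  by have [? ?] := mpart k (c k).1 (c k).2; exact: measurableI.
have mE (c : split_type nx ny) b : measurable (split_event X Y c i b A1 A2 C D).
  exact: (data_measurable mX mY (split_event_data c i b mA1 mA2 mC mD)).
pose T b k w := Tstat (fun j : 'I_(nx k) => X k j w)
  (fun j : 'I_(ny k) => Y k j w) (partx k w) (party k w) b.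
(* Partition by the realised split [c]: on [cfg c] the statistics are those of the fixed split, and
   independence factors each term. Both sides of the claim are instances, at [b = false] and
   [b = true]. *)
have decomp b : P [set w | [/\ A1 (T b i w), A2 (T (~~ b) i w) &
      forall k, k != i -> C k (T false k w) /\ D k (T true k w)]] =
    (\sum_(c \in [set: split_type nx ny])
       P (cfg c) * P (split_event X Y c i b A1 A2 C D))%E.
  rewrite [X in P X](_ : _ = \bigcup_(c in [set: split_type nx ny])
      (cfg c `&` split_event X Y c i b A1 A2 C D)).
    rewrite measure_fin_bigcup//=.
    - apply: eq_fsbigr => c _; apply: (indep (fun k => (c k).1) (fun k => (c k).2)).
      exact: split_event_data.
    - exact: finite_finset.
    - move=> c c' _ _ [w [[cw _] [c'w _]]]; apply/ffunP => k.
      rewrite [LHS]surjective_pairing -(cw k).1 -(cw k).2 (c'w k).1 (c'w k).2.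
      exact/esym/surjective_pairing.
    - by move=> c _; exact: measurableI.
  apply/seteqP; split=> w.
    move=> [A1w A2w CDw]; exists [ffun k => (partx k w, party k w)]; first by [].
    split; first by move=> k; rewrite ffunE.
    by split; [move=> k /CDw|]; rewrite /stat_split/= !ffunE.
  move=> [c _ [cw [CDw [A1w A2w]]]].
  have TE b' k : T b' k w = stat_split X Y c b' k w.
    by rewrite /stat_split; have [<- <-] := cw k.
  by split=> [||k /CDw]; rewrite !TE.
apply: (etrans (decomp false)); apply: etrans (esym (decomp true)).
apply: eq_fsbigr => c _.
(* A configuration that never occurs contributes 0; otherwise an outcome [w] realising it provides
   the sizes of its halves. *)
have [->|/set0P[w cw]] := eqVneq (cfg c) set0; first by rewrite measure0 !mul0e.
have half_lt n : (4 <= n)%N -> (0 < n - uphalf n)%N.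
  by rewrite uphalf_half -{2 3}(odd_double_half n); case: (odd n) => /=; lia.
congr (_ * _)%E; apply: (split_event_swap mX mY (mu := mux i)) => //.
(* Under the null the two means agree, so one centre of reflection serves both samples. *)
- by rewrite {2}muE; exact: Hlaw.
- by have [<- _] := cw i; rewrite cardsCs finset.setCK (Hcard i w).1 card_ord half_lt// (n4 i).1.
- by have [_ <-] := cw i; rewrite cardsCs finset.setCK (Hcard i w).2 card_ord half_lt// (n4 i).2.
Qed.
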